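(* Let $k$ be a positive integer, let $H$ be a $k$-connected graph, and let $W$ be a possibly empty subset of $V(H)$. Set $w=|W|$. Suppose that $E(H-W)\neq\emptyset$. If $d_H(x)\ge h(k,w)$ for every $x\in V(H)\setminus W$, where \[ h(k,w):=\max\Bigl\{\,k+\Bigl\lceil\tfrac{w+1}{4}\Bigr\rceil,\ \min\Bigl\{k+\Bigl\lceil\tfrac{w+1}{2}\Bigr\rceil,\ w+2\Bigr\}\Bigr\}, \] then $H$ has a $k$-removable edge with both ends in $V(H)\setminus W$.
   Context: All graphs are finite, undirected and simple. $d_H(x)$ denotes the degree of $x$ in $H$, and $H-W$ is the graph obtained from $H$ by deleting the vertices in $W$ and all incident edges. A graph is $k$-connected if it has at least $k+1$ vertices and deleting any set of at most $k-1$ vertices leaves a connected graph. An edge $e$ of a $k$-connected graph $H$ is $k$-removable if the graph $H-e$, obtained by deleting the edge $e$ (keeping all vertices), is $k$-connected. *)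

(* Defs.v *)
From mathcomp Require Import all_boot.
Set Implicit Arguments.
Unset Strict Implicit.
Unset Printing Implicit Defensive.

Record sgraph := SGraph {
  vertex :> finType;
  adj : rel vertex;
  adj_sym : symmetric adj;
  adj_irrefl : irreflexive adj
}.

(* An edge is the two-element set of its ends. *)
Definition edges (G : sgraph) : {set {set G}} :=
  [set [set p.1; p.2] | p : G * G & adj p.1 p.2].

Lemma in_edges (G : sgraph) (x y : G) : ([set x; y] \in edges G) = adj x y.
Proof.
apply/imsetP/idP => [[[a b] /= + eqS]|xy]; last first.
  by exists (x, y); rewrite ?inE.
rewrite inE /= => ab.
have /setP/(_ a) := eqS; have /setP/(_ b) := eqS.
have a'b : b != a by apply: contraTneq ab => ->; rewrite adj_irrefl.
rewrite !inE !eqxx orbT /=.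
case/orP => /eqP ?; case/orP => /eqP ?; subst.
- by rewrite eqxx in a'b.
- by rewrite adj_sym.
- by [].
- by rewrite eqxx in a'b.
Qed.

Definition degree (G : sgraph) (x : G) : nat := #|[set y | adj x y]|.

Section Deletion.
Variable G : sgraph.

Section Vertices.
Variable S : {set G}.

Definition del_vertices_adj : rel {x : G | x \notin S} :=
  fun x y => adj (val x) (val y).

Lemma del_vertices_adj_sym : symmetric del_vertices_adj.
Proof. by move=> x y; apply: adj_sym. Qed.

Lemma del_vertices_adj_irrefl : irreflexive del_vertices_adj.
Proof. by move=> x; apply: adj_irrefl. Qed.

Definition del_vertices : sgraph :=
  SGraph del_vertices_adj_sym del_vertices_adj_irrefl.
End Vertices.

Section Edge.
Variable e : {set G}.

Definition del_edge_adj : rel G := fun x y => adj x y && ([set x; y] != e).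

Lemma del_edge_adj_sym : symmetric del_edge_adj.
Proof. by move=> x y; rewrite /del_edge_adj adj_sym setUC. Qed.

Lemma del_edge_adj_irrefl : irreflexive del_edge_adj.
Proof. by move=> x; rewrite /del_edge_adj adj_irrefl. Qed.

Definition del_edge : sgraph := SGraph del_edge_adj_sym del_edge_adj_irrefl.
End Edge.

End Deletion.

Definition connected (G : sgraph) : Prop :=
  forall x y : G, connect (@adj G) x y.

(* For k > 0, [#|S| < k] says that at most k - 1 vertices are deleted. *)
Definition k_connected (k : nat) (G : sgraph) : Prop :=
  k.+1 <= #|[set: G]| /\
  forall S : {set G}, #|S| < k -> connected (del_vertices S).

Definition k_removable (k : nat) (G : sgraph) (e : {set G}) : Prop :=
  e \in edges G /\ k_connected k (del_edge e).

(* The ceiling of m / d, for d > 0. *)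
Definition ceil_divn (m d : nat) : nat := (m + d.-1) %/ d.

Lemma ceil_divn_leq (m d n : nat) :
  0 < d -> (ceil_divn m d <= n) = (m <= n * d).
Proof.
case: d => // d _.
by rewrite /ceil_divn -ltnS ltn_divLR //= mulSn addSn addnC ltnS leq_add2l.
Qed.

Definition h (k w : nat) : nat :=
  maxn (k + ceil_divn (w + 1) 4) (minn (k + ceil_divn (w + 1) 2) (w + 2)).

(* Main.v *)
Require Import Defs.
From mathcomp Require Import all_boot.
From mathcomp Require Import zify.

(** Suppose that no edge of [H - W] is removable.  Each edge [xy] of [H - W]
then has a separation: disjoint sides [A] and [B], containing [x] and [y], with
[xy] the only edge between them and fewer than [k] vertices outside [A] and [B].
Uncross the separations [(A, B)] and [(A', B')] of two edges [xy] and [xz] at a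
vertex [x] of degree greater than [k].  Comparing the boundaries of opposite
corners gives one of three outcomes: the corner of [A] and [B'] is again a side
of a separation of [zx]; or [B] is smaller than [A] and has at most [k - 2]
vertices; or [B'] lies outside [A] and is smaller than [A].

If all degrees off [W] are at least [w + 2], each [x] off [W] has two neighbours
off [W], so the three outcomes contradict the choice of a smallest side [A].
Otherwise the degrees are at least [k + ceil((w + 1) / 2)], where
[ceil((w + 1) / 2) >= k].  Choose [A] smallest among the sides containing at
most half of [W]; the degree of [x] gives a neighbour [z] off [W] in [A].  Only
the second outcome remains, and then [y] has degree less than [2k]. *)

(** * Separations crossed by a single edge *)

Section Separations.

Set Implicit Arguments.
Unset Strict Implicit.

Variables (G : sgraph) (k : nat).
Implicit Types (A B S X Y : {set G}) (x y z : G).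

Definition edge_sep x y A B : bool :=
  [&& x \in A, y \in B, [disjoint A & B], #|~: (A :|: B)| < k &
   [forall a in A, forall b in B, adj a b ==> (a == x) && (b == y)]].

Lemma edge_sepP x y A B :
  reflect [/\ x \in A, y \in B, forall u, u \in A -> u \in B -> False,
              #|~: (A :|: B)| < k &
              forall a b, a \in A -> b \in B -> adj a b -> a = x /\ b = y]
          (edge_sep x y A B).
Proof.
apply: (iffP and5P) => [[Ax By dAB cS /'forall_in_forall_inP adjAB] |
                        [Ax By dAB cS adjAB]]; split=> //.
- by move=> u Au; rewrite (disjointFr dAB Au).
- by move=> a b Aa Bb ab; have /implyP/(_ ab)/andP[/eqP-> /eqP->] := adjAB _ Aa _ Bb.
- by apply/pred0P=> u /=; apply/negP=> /andP[/dAB].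
- apply/'forall_in_forall_inP => a Aa b Bb; apply/implyP=> ab.
  by have [-> ->] := adjAB _ _ Aa Bb ab; rewrite !eqxx.
Qed.

Lemma edge_sepC x y A B : edge_sep x y A B -> edge_sep y x B A.
Proof.
case/edge_sepP=> Ax By dAB cS adjAB; apply/edge_sepP; split=> //.
- by move=> u Bu Au; apply: (dAB u).
- by rewrite setUC.
- by move=> b a Bb Aa; rewrite adj_sym => /(adjAB _ _ Aa Bb)[-> ->].
Qed.

(** Otherwise deleting the complement of [X :|: Y] leaves a connected graph in which [X] is closed
    under adjacency, yet contains [x] and misses [y]. *)
Lemma k_connected_boundary X Y x y :
  k_connected k G -> x \in X -> y \in Y ->
  (forall u, u \in X -> u \in Y -> False) ->
  (forall u v, u \in X -> v \in Y -> ~~ adj u v) ->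
  k <= #|~: (X :|: Y)|.
Proof.
case=> _ kG Xx Yy dXY noXY; rewrite leqNgt; apply/negP=> /kG conn.
have xS : x \notin ~: (X :|: Y) by rewrite !inE Xx.
have yS : y \notin ~: (X :|: Y) by rewrite !inE Yy orbT.
have := conn (exist _ x xS) (exist _ y yS).
set D := del_vertices _.
have clX : closed (@adj D) [pred u : D | val u \in X].
  apply: intro_closed; first exact/sym_connect_sym/adj_sym.
  move=> u v uv /= Xu; have := valP v; rewrite /= !inE negbK.
  by case/orP=> // /(noXY _ _ Xu); rewrite (uv : adj (val u) (val v)).
by move/(closed_connect clX); rewrite !inE /= Xx => /esym /dXY/(_ Yy).
Qed.

(** If fewer than [k] vertices disconnect the graph without the edge, a component of what remains
    and the union of the others are the two sides of a separation. *)
Lemma del_edge_sep x y :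
  k_connected k G -> (forall A B, ~~ edge_sep x y A B) ->
  k_connected k (del_edge [set x; y]).
Proof.
move=> kG noSep; split=> [|S cS u v]; first by case: kG.
apply/negPn/negP=> Nuv.
set D := del_vertices S in u v Nuv.
have symD : connect_sym (@adj D) by apply/sym_connect_sym/adj_sym.
pose A : {set G} := [set val a | a : D & connect (@adj D) u a].
pose B : {set G} := [set val b | b : D & ~~ connect (@adj D) u b].
have dAB w : w \in A -> w \in B -> False.
  case/imsetP=> a; rewrite inE => ua -> /imsetP[b]; rewrite inE => ub.
  by move/val_inj=> ab; rewrite -ab ua in ub.
have sAB : ~: (A :|: B) \subset S.
  apply/subsetP=> w; rewrite !inE; apply: contraR => wS.
  pose d : D := exist _ w wS.
  case ud : (connect (@adj D) u d).
    by apply/orP; left; apply/imsetP; exists d; rewrite ?inE.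
  by apply/orP; right; apply/imsetP; exists d; rewrite ?inE ?ud.
have cAB := leq_ltn_trans (subset_leq_card sAB) cS.
have adjAB a b : a \in A -> b \in B -> adj a b -> [set a; b] = [set x; y].
  case/imsetP=> a'; rewrite inE => ua' -> /imsetP[b']; rewrite inE => ub' -> ab.
  apply/eqP; apply: contraNT ub' => e; apply: connect_trans ua' (connect1 _).
  by apply/andP; split.
have Au : val u \in A by apply: imset_f; rewrite inE connect0.
have Bv : val v \in B by apply: imset_f; rewrite inE.
(* Since [G] is [k]-connected, some edge joins [A] to [B]; by [adjAB] it is the deleted one. *)
have [/exists_inP[a Aa /exists_inP[b Bb ab]]|noAB] :=
    boolP [exists a in A, exists b in B, adj a b]; last first.
  suff: k <= #|~: (A :|: B)| by rewrite leqNgt cAB.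
  apply: (@k_connected_boundary A B (val u) (val v)) => // a b Aa Bb.
  by apply: contraNN noAB => ab; apply/exists_inP; exists a => //;
     apply/exists_inP; exists b.
have sepAB : edge_sep a b A B.
  apply/edge_sepP; split=> // c d Ac Bd cd.
  have := adjAB _ _ Ac Bd cd; rewrite -(adjAB _ _ Aa Bb ab) => /setP eqS.
  have := eqS c; have := eqS d; rewrite !inE !eqxx orbT /=.
  case/esym/orP=> /eqP Ed; first by case: (dAB a Aa); rewrite -Ed.
  by case/esym/orP=> /eqP Ec //; case: (dAB b _ Bb); rewrite -Ec.
have := adjAB _ _ Aa Bb ab => /setP eqS.
have := eqS a; have := eqS b; rewrite !inE !eqxx orbT /=.
case/esym/orP=> /eqP Eb; case/esym/orP=> /eqP Ea.
- by case: (dAB a Aa); rewrite Ea -Eb.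
- by have := noSep B A; rewrite -Ea -Eb edge_sepC.
- by have := noSep A B; rewrite -Ea -Eb sepAB.
- by case: (dAB a Aa); rewrite Ea -Eb.
Qed.

Lemma degree_le x S : (forall u, adj x u -> u \in S) -> degree x <= #|S|.
Proof. by move=> NS; apply/subset_leq_card/subsetP=> u; rewrite inE => /NS. Qed.

(** A neighbour of [x] is another vertex of [A], or [y], or one of the at most [k - 1] boundary
    vertices. *)
Lemma edge_sep_degree x y A B :
  edge_sep x y A B -> degree x < #|A| + k.
Proof.
case/edge_sepP=> Ax By dAB cS adjAB.
have : degree x <= #|(A :\ x) :|: (y |: ~: (A :|: B))|.
  apply: degree_le => u xu; rewrite !inE.
  have [ux|_] := eqVneq u x; first by rewrite ux adj_irrefl in xu.
  case Au : (u \in A) => //=; case Bu : (u \in B); last by rewrite orbT.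
  by have [_ ->] := adjAB _ _ Ax Bu xu; rewrite eqxx.
have := leq_of_leqif (leq_card_setU (A :\ x) (y |: ~: (A :|: B))).
have := cardsU1 y (~: (A :|: B)).
have := cardsD1 x A; rewrite Ax !inE By orbT /=; lia.
Qed.

(** * Uncrossing two separations at a common vertex *)

Lemma card_sum_mem S : #|S| = \sum_u (u \in S).
Proof. by rewrite -sum1_card big_mkcond; apply: eq_bigr => u _; case: (u \in S). Qed.

(** Each vertex contributes equally to both sides, whichever of [A], [B] and of [A'], [B'] contains
    it, if any. *)
Lemma card_corner_boundaries A B A' B' :
  (forall u, u \in A -> u \in B -> False) ->
  (forall u, u \in A' -> u \in B' -> False) ->
  #|~: (A :&: A' :|: (B :|: B'))| + #|~: (B :&: B' :|: (A :|: A'))|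
    = #|~: (A :|: B)| + #|~: (A' :|: B')|.
Proof.
move=> dAB dAB'; rewrite !card_sum_mem -!big_split /=.
apply: eq_bigr => u _; rewrite !inE.
move: (dAB u) (dAB' u).
by case: (u \in A) (u \in B) (u \in A') (u \in B') => [] [] [] [] // a b;
  (try by case: a); (try by case: b).
Qed.

Lemma uncross_edge_sep x y z A B A' B' :
  k_connected k G -> k < degree x -> y != z -> adj x y -> adj x z ->
  edge_sep x y A B -> edge_sep x z A' B' ->
  [\/ z \in A /\ edge_sep z x (A :&: B') (A' :|: B),
      #|B| < #|A| /\ #|B| + 2 <= k |
      z \notin A /\ #|B'| < #|A|].
Proof.
move=> kG degx yz xy xz.
move=> /edge_sepP[Ax By dAB cS adjAB] /edge_sepP[A'x B'z dAB' cS' adjAB'].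
have Bx : x \notin B by apply/negP; apply: dAB.
have B'x : x \notin B' by apply/negP; apply: dAB'.
have B'y : y \notin B'.
  by apply/negP=> B'y; have [_ /eqP] := adjAB' _ _ A'x B'y xy; apply/negP.
have Bz : z \notin B.
  by apply/negP=> Bz; have [_ /eqP] := adjAB _ _ Ax Bz xz; rewrite eq_sym; apply/negP.
have A'z : z \notin A' by apply/negP=> /dAB'; apply.
have dBA u : u \in B -> u \in A -> False by move=> ? ?; apply: (dAB u).
have sumAA' := card_corner_boundaries dAB dAB'.
have sumBA' := card_corner_boundaries dBA dAB'.
rewrite [B :|: A]setUC in sumBA'.
(* [S1], [S2], [S3], [S4] are the boundaries of the corners of [A] and [A'],
   [A] and [B'], [B] and [A'], [B] and [B']. *)
set S := ~: (A :|: B) in cS sumAA' sumBA'.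
set S' := ~: (A' :|: B') in cS' sumAA' sumBA'.
set S1 := ~: (A :&: A' :|: _) in sumAA'.
set S4 := ~: (_ :|: _) in sumAA'.
set S3 := ~: (_ :|: _) in sumBA'.
set S2 := ~: (_ :|: _) in sumBA'.
(* If the corner has a vertex besides [x], moving [x] to the boundary leaves no edge across.
   Otherwise all neighbours of [x] are [y], [z] or in [S1], and [degx] applies. *)
have leS1 : k <= #|S1|.+1.
  have [[u]|/existsPn noAA'] := altP (@existsP G (mem (A :&: A' :\ x))).
    rewrite !inE => /and3P[ux Au A'u].
    have : k <= #|~: ((A :&: A' :\ x) :|: (B :|: B'))|.
      apply: (@k_connected_boundary _ _ u y) => //; rewrite ?inE ?ux ?Au ?By //.
        move=> v; rewrite !inE => /and3P[_ Av A'v] /orP[Bv|B'v].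
          exact: (dAB v).
        exact: (dAB' v).
      move=> v v'; rewrite !inE => /and3P[vx Av A'v] /orP[Bv'|B'v'].
        by apply: contraNN vx => vv'; have [-> _] := adjAB _ _ Av Bv' vv'.
      by apply: contraNN vx => vv'; have [-> _] := adjAB' _ _ A'v B'v' vv'.
    move/leq_trans; apply.
    apply: leq_trans (_ : #|x |: S1| <= _); last by rewrite cardsU1; case: (_ \notin _).
    apply/subset_leq_card/subsetP=> v; rewrite !inE.
    by case: (v == x) (v \in A) (v \in A') => [] [] [].
  have : degree x <= #|y |: (z |: S1)|.
    apply: degree_le => u xu; rewrite !inE.
    have ux : u != x by apply: contraTneq xu => ->; rewrite adj_irrefl.
    have := noAA' u; rewrite /= !inE ux /= => /negbTE ->.
    case Bu : (u \in B) => /=.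
      by have [_ ->] := adjAB _ _ Ax Bu xu; rewrite eqxx.
    case B'u : (u \in B') => /=; last by rewrite !orbT.
    by have [_ ->] := adjAB' _ _ A'x B'u xu; rewrite eqxx orbT.
  move: (cardsU1 y (z |: S1)) (cardsU1 z S1) (leq_b1 (y \notin z |: S1)) (leq_b1 (z \notin S1)).
  by clear -degx; lia.
(* By [leS1] and [sumAA'], [S4] has fewer than [k] vertices, too few to cut off a nonempty
   corner. *)
have BB'0 u : u \in B -> u \in B' -> False.
  move=> Bu B'u; suff leS4 : k <= #|S4| by clear -leS4 leS1 sumAA' cS cS'; lia.
  apply: (@k_connected_boundary _ _ u x) => //; rewrite ?inE ?Bu ?Ax //.
    by move=> v; rewrite !inE => /andP[Bv B'v] /orP[/dAB|/dAB']; apply.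
  move=> v v'; rewrite !inE => /andP[Bv B'v] /orP[Av'|A'v']; rewrite adj_sym.
    by apply: contraNN B'y => /(adjAB _ _ Av' Bv)[_ <-].
  by apply: contraNN Bz => /(adjAB' _ _ A'v' B'v)[_ <-].
have leAS : #|S :&: B'| <= #|S' :&: A|.
  suff eqS1 : #|S1| + #|S :&: B'| = #|S| + #|S' :&: A|
    by clear -eqS1 leS1 cS; lia.
  rewrite !card_sum_mem -!big_split /=.
  apply: eq_bigr => u _; rewrite !inE; move: (dAB u) (dAB' u) (BB'0 u).
  by case: (u \in A) (u \in B) (u \in A') (u \in B') => [] [] [] [] // a b c;
    (try by case: a); (try by case: b); (try by case: c).
have ltSA : #|S' :&: A| < #|A|.
  apply/proper_card/properP; split; first exact: subsetIr.
  by exists x; rewrite // !inE A'x.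
(* If this corner is empty too, [B'] lies inside [S], and [leAS] bounds its size. *)
have [AB'0|] := eqVneq (A :&: B') set0.
  apply: Or33; split; first by apply/negP=> Az; move/setP/(_ z): AB'0; rewrite !inE Az B'z.
  apply: leq_ltn_trans ltSA; apply: leq_trans leAS.
  apply/subset_leq_card/subsetP=> u B'u; rewrite !inE B'u andbT.
  apply/negP=> /orP[Au|Bu]; last exact: (BB'0 u).
  by move/setP/(_ u): AB'0; rewrite !inE Au B'u.
case/set0Pn=> u; rewrite inE => /andP[Au B'u].
have dAB'BA' v : v \in A :&: B' -> v \in A' :|: B -> False.
  by rewrite !inE => /andP[Av B'v] /orP[/dAB'|/(dAB v Av)] //; apply.
have adjAB'BA' v v' : v \in A :&: B' -> v' \in A' :|: B -> adj v v' -> v = z /\ v' = x.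
  rewrite !inE => /andP[Av B'v] /orP[A'v'|Bv'] vv'.
    by have [] := adjAB' _ _ A'v' B'v; rewrite 1?adj_sym.
  by have [Ev _] := adjAB _ _ Av Bv' vv'; rewrite -Ev B'v in B'x.
have eqS2 : ~: (A :&: B' :|: (A' :|: B)) = S2 by rewrite [A' :|: B]setUC.
have [ltS2|leS2] := ltnP #|S2| k.
  apply: Or31.
  have [Az|Az] := boolP (z \in A).
    by split=> //; apply/edge_sepP; split; rewrite ?eqS2 // !inE ?Az ?A'x.
  suff leS2 : k <= #|S2| by rewrite ltnNge leS2 in ltS2.
  rewrite -eqS2; apply: (@k_connected_boundary _ _ u x) => //; rewrite ?inE ?Au ?A'x //.
  move=> v v' ABv BAv'; apply: contraNN Az => vv'.
  have [<- _] := adjAB'BA' _ _ ABv BAv' vv'.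
  by move: ABv; rewrite inE => /andP[].
(* Now [S3] has at most [k - 2] vertices. All edges leaving this corner end at [x], and adding [x]
   to [S3] still gives fewer than [k] vertices. *)
have BA'0 v : v \in B -> v \in A' -> False.
  move=> Bv A'v.
  have : k <= #|~: (B :&: A' :|: ((A :|: B') :\ x))|.
    apply: (@k_connected_boundary _ _ v z) => //; rewrite ?inE ?Bv ?B'z ?orbT ?andbT //.
    - by apply: contraNneq B'x => <-.
    - move=> t; rewrite !inE => /andP[Bt A't] /andP[_ /orP[At|B't]].
        exact: (dAB t).
      exact: (dAB' t).
    move=> t t'; rewrite !inE => /andP[Bt A't] /andP[tx /orP[At'|B't']].
      by rewrite adj_sym; apply: contraNN tx => /(adjAB _ _ At' Bt)[-> _].
    by apply: contraNN Bx => /(adjAB' _ _ A't B't')[<- _].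
  have : #|~: (B :&: A' :|: ((A :|: B') :\ x))| <= #|x |: S3|.
    apply/subset_leq_card/subsetP=> t; rewrite !inE.
    by case: (t == x) (t \in A) (t \in B') => [] [] [].
  move: (cardsU1 x S3) (leq_b1 (x \notin S3)).
  by clear -leS2 sumBA' cS cS'; lia.
have cB : #|B| = #|S' :&: B|.
  congr #|pred_of_set _|; apply/setP=> t; rewrite !inE.
  case Bt: (t \in B); last by rewrite andbF.
  rewrite andbT; apply/esym/norP; split; apply/negP=> ?; first exact: (BA'0 t).
  exact: (BB'0 t).
(* As [S2] is larger than [S'], this makes [B] smaller than [S :&: B'], hence smaller than both [S]
   and [A]. *)
have : #|S2| + #|S' :&: B| = #|S'| + #|S :&: B'|.
  rewrite !card_sum_mem -!big_split /=.
  apply: eq_bigr => t _; rewrite !inE; move: (dAB t) (dAB' t) (BB'0 t).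
  by case: (t \in A) (t \in B) (t \in A') (t \in B') => [] [] [] [] // a b c;
    (try by case: a); (try by case: b); (try by case: c).
move: (subset_leq_card (subsetIl S B')) => leSB' eqS'.
by apply: Or32; clear -leS2 leAS ltSA cB cS cS' leSB' eqS'; split; lia.
Qed.

End Separations.

(** * Descent on the size of a side *)

Section NoRemovableEdge.

Set Implicit Arguments.
Unset Strict Implicit.

Variables (k : nat) (H : sgraph) (W : {set H}).
Hypothesis kH : k_connected k H.
Hypothesis sepW : forall x y : H, x \notin W -> y \notin W -> adj x y ->
  exists A B, edge_sep k x y A B.
Hypothesis degk : forall x : H, x \notin W -> k < degree x.

Lemma no_removable_edge_large_degree (x y : H) :
  (forall u : H, u \notin W -> #|W| + 2 <= degree u) ->
  x \notin W -> y \notin W -> adj x y -> False.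
Proof.
move=> degW Wx Wy xy; have [A [B sepAB]] := sepW Wx Wy xy.
have [n] := ubnP #|A|; elim: n => // n IHn in x y A B Wx Wy xy sepAB *.
rewrite ltnS => leA.
(* Only [#|W| + 1] neighbours of [x] can be [y] or lie in [W]. *)
have [z xz /norP[zy Wz]] : exists2 z, adj x z & ~~ ((z == y) || (z \in W)).
  have [[z /andP[]]|/existsPn noz] :=
    altP (@existsP H (fun z => adj x z && ~~ ((z == y) || (z \in W)))).
    by exists z.
  have : degree x <= #|y |: W|.
    by apply: degree_le => z xz; have := noz z; rewrite xz negbK !inE.
  by have := degW x Wx; have := cardsU1 y W; lia.
have [A' [B' sepAB']] := sepW Wx Wz xz.
rewrite eq_sym in zy.
have [[Az sepz]|[ltBA _]|[_ ltBA]] :=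
  uncross_edge_sep kH (degk Wx) zy xy xz sepAB sepAB'.
- apply: (IHn _ _ _ _ Wz Wx _ sepz); first by rewrite adj_sym.
  apply: leq_trans leA; apply/proper_card/properP; split; first exact: subsetIl.
  case/edge_sepP: sepAB => Ax _ _ _ _; exists x => //.
  case/edge_sepP: sepAB' => A'x _ dAB' _ _.
  by rewrite inE Ax; apply/negP=> /dAB'; apply.
- apply: (IHn y x B A) => //; [by rewrite adj_sym | exact: edge_sepC | exact: leq_trans leA].
- apply: (IHn z x B' A') => //; [by rewrite adj_sym | exact: edge_sepC | exact: leq_trans leA].
Qed.

(** The descent passes only to subsets of [A], which keeps the bound on [#|A :&: W|]; the side [B]
    may meet [W] in too many vertices. *)
Lemma no_removable_edge_large_set (x y : H) (d : nat) :
  k <= d -> #|W| < d.*2 ->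
  (forall u : H, u \notin W -> k + d <= degree u) ->
  x \notin W -> y \notin W -> adj x y -> False.
Proof.
move=> kd Wd degW Wx Wy xy.
have {x y Wx Wy xy} [x [y [A [B [Wx Wy xy sepAB leAW]]]]] : exists x y A B,
    [/\ x \notin W, y \notin W, adj x y, edge_sep k x y A B & #|A :&: W| < d].
  have [A [B sepAB]] := sepW Wx Wy xy.
  have [ltAW|leAW] := ltnP #|A :&: W| d; first by exists x, y, A, B.
  exists y, x, B, A; split; rewrite 1?adj_sym //; first exact: edge_sepC.
  have : #|B :&: W| <= #|W :\: A|.
    apply/subset_leq_card/subsetP=> u; rewrite !inE => /andP[Bu ->]; rewrite andbT.
    by case/edge_sepP: sepAB => _ _ dAB _ _; apply/negP=> /dAB; apply.
  by have := cardsID A W; rewrite [W :&: A]setIC; lia.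
have [n] := ubnP #|A|; elim: n => // n IHn in x y A B Wx Wy xy sepAB leAW *.
rewrite ltnS => leA.
have /edge_sepP[Ax By dAB cS adjAB] := sepAB.
(* The other neighbours of [x] number at most [k + (d - 1)]: [y], the boundary, and [A :&: W]. *)
have [z xz /andP[Az Wz]] : exists2 z, adj x z & (z \in A) && (z \notin W).
  have [[z /andP[]]|/existsPn noz] :=
    altP (@existsP H (fun z => adj x z && ((z \in A) && (z \notin W)))).
    by exists z.
  have : degree x <= #|(y |: ~: (A :|: B)) :|: (A :&: W)|.
    apply: degree_le => z xz; have := noz z; rewrite xz !inE.
    case: (z \in A) => /=; first by rewrite negbK => ->; rewrite !orbT.
    case Bz : (z \in B); last by rewrite orbT.
    by have [_ ->] := adjAB _ _ Ax Bz xz; rewrite eqxx.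
  have := degW x Wx; have := leq_of_leqif (leq_card_setU (y |: ~: (A :|: B)) (A :&: W)).
  move: (cardsU1 y (~: (A :|: B))) (leq_b1 (y \notin ~: (A :|: B))).
  by clear -leAW cS; lia.
have [A' [B' sepAB']] := sepW Wx Wz xz.
have yz : y != z by apply/negP=> /eqP E; apply: (dAB z); rewrite // -E.
have [[_ sepz]|[_ leB]|[]] :=
  uncross_edge_sep kH (degk Wx) yz xy xz sepAB sepAB'.
- apply: (IHn _ _ _ _ Wz Wx _ sepz); first by rewrite adj_sym.
    by apply: leq_ltn_trans leAW; apply/subset_leq_card/setSI/subsetIl.
  apply: leq_trans leA; apply/proper_card/properP; split; first exact: subsetIl.
  exists x => //; case/edge_sepP: sepAB' => A'x _ dAB' _ _.
  by rewrite inE Ax; apply/negP=> /dAB'; apply.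
- have := edge_sep_degree (edge_sepC sepAB).
  by move: (degW y Wy) leB kd; clear; lia.
- by rewrite Az.
Qed.

End NoRemovableEdge.

Theorem theorem3p1 (k : nat) (H : sgraph) (W : {set H}) :
  0 < k ->
  k_connected k H ->
  edges (del_vertices W) != set0 ->
  (forall x : H, x \notin W -> h k #|W| <= degree x) ->
  exists e : {set H}, k_removable k e /\ e \subset ~: W.
Proof.
move=> _ kH /set0Pn[e /imsetP[[a b]]]; rewrite inE /= => ab _ degh.
have [/existsP[[x y] /and4P[/= Wx Wy xy /existsPn noSep]]|/existsPn sepW] :=
  boolP [exists p : H * H, [&& p.1 \notin W, p.2 \notin W, adj p.1 p.2 &
    ~~ [exists q, edge_sep k p.1 p.2 q.1 q.2]]].
  exists [set x; y]; split; last by apply/subsetP=> u /set2P[]->; rewrite inE.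
  split; first by rewrite in_edges.
  by apply: del_edge_sep => // A B; have := noSep (A, B).
have {}sepW x y : x \notin W -> y \notin W -> adj x y ->
    exists A B, edge_sep k x y A B.
  move=> Wx Wy xy; have := sepW (x, y); rewrite /= Wx Wy xy /= negbK.
  by case/existsP=> [[A B]]; exists A, B.
have degk x : x \notin W -> k < degree x.
  by move=> /degh; rewrite /h /ceil_divn; lia.
(* If [h] is below [w + 2], the minimum is [k + d] with [d] the ceiling of [(w + 1) / 2]; then
   [k + d <= w + 1 <= 2 * d] yields [k <= d]. *)
exfalso; have [large|small] := leqP (#|W| + 2) (h k #|W|).
  apply: (no_removable_edge_large_degree kH sepW degk _ (valP a) (valP b) ab).
  by move=> u /degh; apply: leq_trans.
apply: (no_removable_edge_large_set kH sepW degk (d := ceil_divn (#|W| + 1) 2)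
          _ _ _ (valP a) (valP b) ab).
- by move: small; rewrite /h /ceil_divn; lia.
- by rewrite /ceil_divn; lia.
- by move=> u /degh; move: small; rewrite /h /ceil_divn; lia.
Qed.
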